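(* Let $X$ be a non-empty set and $R$ a binary relation on $X$. Then $\overline{R}$ has as realizer the set of linear-interval order extensions of $R$ if and only if $R$ is acyclic.
   Context: For a binary relation $R$ on a set $X$, the asymmetric part is $P(R)=\{(x,y)\in X\times X : (x,y)\in R \text{ and } (y,x)\notin R\}$. The transitive closure $\overline{R}$ is defined by: $(x,y)\in\overline{R}$ iff there exist $m\geq 1$ and $z_0,\dots,z_m\in X$ with $x=z_0$, $z_m=y$ and $(z_k,z_{k+1})\in R$ for all $0\le k\le m-1$. An $R$-cycle is a non-empty subset $Y\subseteq X$ such that $(x,y)\in\overline{R}$ and $(y,x)\in\overline{R}$ for all $x,y\in Y$; $R$ is acyclic if there is no $R$-cycle. A relation $R^*$ on $X$ is an extension of $R$ if $R\subseteq R^*$ and $P(R)\subseteq P(R^* )$. A linear order is a reflexive, transitive, antisymmetric relation that is total (for all $x\neq y$, $xRy$ or $yRx$). An interval order is an irreflexive and transitive relation $R$ satisfying the Russell-Wiener axiom: for all $x,y,z,w\in X$, $(x,y)\in R$, $(z,y)\notin R$ and $(z,w)\in R$ imply $(x,w)\in R$. An acyclic binary relation $R$ is called a linear-interval order if there exist a linear order $L$ and an interval order $Q$ on $X$ such that $\overline{R}=L\cap Q$. A linear-interval order extension of $R$ is an extension of $R$ that is a linear-interval order. A set $\mathcal{Q}$ of relations on $X$ is a realizer of a relation $S$ if $\mathcal{Q}$ is non-empty and $S=\bigcap_{Q\in\mathcal{Q}}Q$.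
   Formalization: The realizer consists of the transitive closures of the linear-interval order extensions of R (equivalently, the transitive such extensions); literally the claim fails, e.g. R={(a,b),(b,c)} on {a,b,c} is its own extension and misses (a,c). *)

(* Defs.v *)
From Stdlib Require Export Relations.

Set Implicit Arguments.
Unset Strict Implicit.

Section BinaryRelations.

Variable X : Type.
Implicit Types (R S L Q : relation X) (Y : X -> Prop) (F : relation X -> Prop).

Definition asym_part R : relation X := fun x y => R x y /\ ~ R y x.

(* [x = y] is allowed, so a singleton [{x}] is a cycle as soon as the
   transitive closure relates [x] to itself. *)
Definition is_cycle R Y : Prop :=
  (exists x, Y x) /\
  (forall x y, Y x -> Y y -> clos_trans X R x y /\ clos_trans X R y x).

Definition acyclic R : Prop := ~ exists Y, is_cycle R Y.

Definition is_extension R S : Prop :=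
  inclusion X R S /\ inclusion X (asym_part R) (asym_part S).

Definition linear_order L : Prop :=
  order X L /\ (forall x y, x <> y -> L x y \/ L y x).

Definition interval_order Q : Prop :=
  (forall x, ~ Q x x) /\ transitive X Q /\
  (forall x y z w, Q x y -> ~ Q z y -> Q z w -> Q x w).

Definition rel_inter L Q : relation X := fun x y => L x y /\ Q x y.

Definition linear_interval_order R : Prop :=
  acyclic R /\
  exists L Q, linear_order L /\ interval_order Q /\
    same_relation X (clos_trans X R) (rel_inter L Q).

Definition linear_interval_extension R S : Prop :=
  is_extension R S /\ linear_interval_order S.

Definition rel_bigcap F : relation X := fun x y => forall Q, F Q -> Q x y.

Definition is_realizer F S : Prop :=
  (exists Q, F Q) /\ same_relation X S (rel_bigcap F).

(* A linear-interval order [S] need not be transitive: it is its transitive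
   closure that equals [L ∩ Q].  For a realizer, each extension [S] has to be
   read as the transitive relation [L ∩ Q] it represents: if
   [R = {(1,2), (2,3)}] on [{1,2,3}], then [R] is a linear-interval order
   extension of itself that misses the pair (1,3) of its closure, so the
   non-closed extensions never realize [clos_trans X R].
   The closures of the linear-interval order extensions of [R] are exactly
   the transitive linear-interval order extensions of [R]. *)
Definition linear_interval_extension_closures R : relation X -> Prop :=
  fun T => exists S, linear_interval_extension R S /\ T = clos_trans X S.

End BinaryRelations.

(* Main.v *)
Require Import Defs.
From Stdlib Require Import RelationClasses Classical.
From mathcomp Require classical_sets.

(** Both directions rest on two observations.

    A relation is acyclic exactly when its transitive closure is irreflexive,
    that is, when the closure is a strict order.  So any acyclic relation
    containing [R] forces [R] to be acyclic, which settles the implication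
    from left to right: a realizer is non-empty.

    Conversely, every total strict order [M] is a linear-interval order: it is
    the intersection of its reflexive closure, a linear order, with itself, an
    interval order.  If [M] contains an acyclic [R], then [M] extends [R],
    because the asymmetric part of [M] is [M].  It is therefore enough to
    realize the strict order [clos_trans X R] by total strict orders, and this
    is the theorem of Szpilrajn and of Dushnik and Miller: if [(x, y)] is not in
    a strict order [P] and [x <> y], then [P] may be enlarged to contain
    [(y, x)] ([strict_order_add_pair]) and then to be total
    ([strict_order_linear_extension], by Zorn's lemma); the result omits
    [(x, y)].  Pairs [(x, x)] are omitted by any total strict order. *)

(** * Acyclicity *)

(** A point related to itself by the closure is a one-element cycle. *)
Lemma acyclicP (X : Type) (R : relation X) :
  acyclic R <-> forall x, ~ clos_trans X R x x.
Proof.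
  split.
  - intros HR x Hx. apply HR. exists (eq x). split.
    + now exists x.
    + now intros y z <- <-.
  - intros HR (Y & (x & Yx) & HY). exact (HR x (proj1 (HY x x Yx Yx))).
Qed.

Lemma clos_trans_incl (X : Type) (R S : relation X) :
  inclusion X R S -> inclusion X (clos_trans X R) (clos_trans X S).
Proof.
  intros RS x y Hxy. induction Hxy as [x y Hxy | x y z _ IHxy _ IHyz].
  - now apply t_step, RS.
  - now apply t_trans with y.
Qed.

Lemma clos_trans_transitive_id (X : Type) (R : relation X) :
  transitive X R -> inclusion X (clos_trans X R) R.
Proof.
  intros HR x y Hxy. induction Hxy as [x y Hxy | x y z _ IHxy _ IHyz].
  - exact Hxy.
  - exact (HR x y z IHxy IHyz).
Qed.

Lemma acyclic_incl (X : Type) (R S : relation X) :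
  inclusion X R S -> acyclic S -> acyclic R.
Proof.
  intros RS HS. apply acyclicP. intros x Hx.
  exact (proj1 (acyclicP X S) HS x (clos_trans_incl X R S RS x x Hx)).
Qed.

Lemma acyclic_clos_trans_strict (X : Type) (R : relation X) :
  acyclic R -> StrictOrder (clos_trans X R).
Proof.
  intros HR. split.
  - exact (proj1 (acyclicP X R) HR).
  - exact (t_trans X R).
Qed.

Lemma strict_order_acyclic (X : Type) (M : relation X) :
  StrictOrder M -> acyclic M.
Proof.
  intros [Mirr Mtr]. apply acyclicP. intros x Hx.
  exact (Mirr x (clos_trans_transitive_id X M Mtr x x Hx)).
Qed.

(** * Linear extensions of strict orders *)

(** The enlarged order also relates everything at or below [a] to everything at
    or above [b].  A new pair cannot be closed into a cycle: its ends would give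
    [b] at or below [a], which the hypotheses exclude. *)
Lemma strict_order_add_pair (X : Type) (P : relation X) (a b : X) :
  StrictOrder P -> a <> b -> ~ P b a ->
  exists M, StrictOrder M /\ inclusion X P M /\ M a b.
Proof.
  intros [Pirr Ptr] ab Pba.
  exists (fun u v => P u v \/ ((u = a \/ P u a) /\ (v = b \/ P b v))).
  split; [split | split].
  - intros u [Puu | [[-> | Pua] [ub | Pbu]]].
    + exact (Pirr u Puu).
    + now apply ab.
    + now apply Pba.
    + subst u. now apply Pba.
    + exact (Pba (Ptr b u a Pbu Pua)).
  - intros u v w [Puv | [Hu Hv]] [Pvw | [Hv' Hw]].
    + left. exact (Ptr u v w Puv Pvw).
    + right. split; [right | exact Hw].
      destruct Hv' as [-> | Pva]; [exact Puv | exact (Ptr u v a Puv Pva)].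
    + right. split; [exact Hu | right].
      destruct Hv as [-> | Pbv]; [exact Pvw | exact (Ptr b v w Pbv Pvw)].
    + right. now split.
  - intros u v Puv. now left.
  - right. now split; left.
Qed.

(** Szpilrajn's theorem.  Zorn's lemma is applied to the sets of pairs whose
    union with [P] is a strict order, rather than to the strict orders that
    contain [P]: this way the union of the empty chain is admissible too. *)
Lemma strict_order_linear_extension (X : Type) (P : relation X) :
  StrictOrder P ->
  exists M, StrictOrder M /\ inclusion X P M /\
    forall a b, a <> b -> M a b \/ M b a.
Proof.
  intros HP.
  pose (with_P := fun (A : X * X -> Prop) x y => A (x, y) \/ P x y).
  destruct (@classical_sets.Zorn_bigcup (X * X)
              (fun A => StrictOrder (with_P A))) as (A & HA & Amax).
  - intros F FP Ftot. split.
    + intros x [[B FB Bxx] | Pxx].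
      * destruct (FP B FB) as [Birr _]. apply (Birr x). now left.
      * destruct HP as [Pirr _]. exact (Pirr x Pxx).
    + (* All pairs at hand lie in a single member of the chain, or in [P]. *)
      assert (in_member : forall B x y z, F B ->
                with_P B x y -> with_P B y z ->
                with_P (classical_sets.bigcup F (fun C => C)) x z).
      { intros B x y z FB Bxy Byz. destruct (FP B FB) as [_ Btr].
        destruct (Btr x y z Bxy Byz) as [Bxz | Pxz].
        - left. now exists B.
        - now right. }
      intros x y z [[B FB Bxy] | Pxy] [[C FC Cyz] | Pyz].
      * destruct (Ftot B C FB FC) as [BC | CB].
        -- apply (in_member C x y z FC); left; [now apply BC | exact Cyz].
        -- apply (in_member B x y z FB); left; [exact Bxy | now apply CB].
      * apply (in_member B x y z FB); [now left | now right].
      * apply (in_member C x y z FC); [now right | now left].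
      * right. destruct HP as [_ Ptr]. exact (Ptr x y z Pxy Pyz).
  - exists (with_P A). split; [exact HA | split].
    + intros x y Pxy. now right.
    + intros a b ab. apply NNPP. intros Hn.
      destruct (strict_order_add_pair X (with_P A) a b HA ab)
        as (M & HM & AM & Mab).
      { intros Hba. apply Hn. now right. }
      apply (Amax (fun p => M (fst p) (snd p))).
      * split.
        -- intros [x y] Axy. apply AM. now left.
        -- intros MA. apply Hn. left. left. now apply (MA (a, b)).
      * destruct HM as [Mirr Mtr].
        assert (MP : forall x y,
                  with_P (fun p => M (fst p) (snd p)) x y -> M x y).
        { intros x y [Mxy | Pxy]; [exact Mxy | apply AM; now right]. }
        split.
        -- intros x Hxx. exact (Mirr x (MP x x Hxx)).
        -- intros x y z Hxy Hyz. left.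
           exact (Mtr x y z (MP x y Hxy) (MP y z Hyz)).
Qed.

(** When [x <> y], the reversed pair [(y, x)] is added before [P] is made total;
    asymmetry then keeps [(x, y)] out. *)
Lemma strict_order_separate (X : Type) (P : relation X) (x y : X) :
  StrictOrder P -> ~ P x y ->
  exists M, StrictOrder M /\ inclusion X P M /\
    (forall a b, a <> b -> M a b \/ M b a) /\ ~ M x y.
Proof.
  intros HP Pxy. destruct (classic (x = y)) as [<- | xy].
  - destruct (strict_order_linear_extension X P HP) as (M & HM & PM & Mtot).
    exists M. split; [exact HM | split; [exact PM | split; [exact Mtot |]]].
    destruct HM as [Mirr _]. exact (Mirr x).
  - destruct (strict_order_add_pair X P y x HP (not_eq_sym xy) Pxy)
      as (P' & HP' & PP' & P'yx).
    destruct (strict_order_linear_extension X P' HP') as (M & HM & PM & Mtot).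
    exists M. split; [exact HM | split; [| split]].
    + intros a b Pab. now apply PM, PP'.
    + exact Mtot.
    + intros Mxy. destruct HM as [Mirr Mtr].
      exact (Mirr x (Mtr x y x Mxy (PM y x P'yx))).
Qed.

(** * Linear-interval extensions *)

(** Totality makes the Russell-Wiener axiom a consequence of transitivity: if
    [(z, y)] is not in [M], then [y] is at or below [z]. *)
Lemma total_strict_order_linear_interval (X : Type) (M : relation X) :
  StrictOrder M -> (forall a b, a <> b -> M a b \/ M b a) ->
  linear_interval_order M.
Proof.
  intros HM Mtot. split; [now apply strict_order_acyclic |].
  destruct HM as [Mirr Mtr].
  exists (fun x y => x = y \/ M x y), M. split; [split; [split |] | split].
  - intros x. now left.
  - intros x y z [-> | Mxy] [-> | Myz]; [now left | now right | now right |].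
    right. exact (Mtr x y z Mxy Myz).
  - intros x y [xy | Mxy] [yx | Myx]; try congruence.
    destruct (Mirr x (Mtr x y x Mxy Myx)).
  - intros x y xy. destruct (Mtot x y xy) as [Mxy | Myx].
    + left. now right.
    + right. now right.
  - split; [exact Mirr | split; [exact Mtr |]].
    intros x y z w Mxy Mzy Mzw.
    destruct (classic (y = z)) as [-> | yz]; [exact (Mtr x z w Mxy Mzw) |].
    destruct (Mtot y z yz) as [Myz | Mzy']; [| now destruct Mzy].
    exact (Mtr x z w (Mtr x y z Mxy Myz) Mzw).
  - split.
    + intros x y Hxy. pose proof (clos_trans_transitive_id X M Mtr x y Hxy).
      split; [now right | assumption].
    + intros x y [_ Mxy]. now apply t_step.
Qed.

Lemma strict_order_extension (X : Type) (R M : relation X) :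
  StrictOrder M -> inclusion X R M -> is_extension R M.
Proof.
  intros [Mirr Mtr] RM. split; [exact RM |].
  intros x y [Rxy _]. split; [now apply RM |].
  intros Myx. exact (Mirr x (Mtr x y x (RM x y Rxy) Myx)).
Qed.

Lemma linear_interval_extension_separate (X : Type) (R : relation X) (x y : X) :
  acyclic R -> ~ clos_trans X R x y ->
  exists S, linear_interval_extension R S /\ ~ clos_trans X S x y.
Proof.
  intros HR Rxy.
  destruct (strict_order_separate X (clos_trans X R) x y
              (acyclic_clos_trans_strict X R HR) Rxy)
    as (M & HM & RM & Mtot & Mxy).
  exists M. split; [split |].
  - apply strict_order_extension; [exact HM |].
    intros a b Rab. now apply RM, t_step.
  - now apply total_strict_order_linear_interval.
  - intros H. apply Mxy. destruct HM as [_ Mtr].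
    exact (clos_trans_transitive_id X M Mtr x y H).
Qed.

Theorem theorem4p9 (X : Type) (hX : inhabited X) (R : relation X) :
  is_realizer (linear_interval_extension_closures R) (clos_trans X R) <->
  acyclic R.
Proof.
  split.
  - intros [(T & S & [[RS _] [HS _]] & _) _].
    exact (acyclic_incl X R S RS HS).
  - intros HR. split.
    + destruct hX as [x].
      destruct (linear_interval_extension_separate X R x x HR
                  (proj1 (acyclicP X R) HR x)) as (S & HS & _).
      exists (clos_trans X S), S. now split.
    + split.
      * intros x y Rxy T (S & [[RS _] _] & ->).
        exact (clos_trans_incl X R S RS x y Rxy).
      * intros x y Hxy. apply NNPP. intros Rxy.
        destruct (linear_interval_extension_separate X R x y HR Rxy)
          as (S & HS & Sxy).
        apply Sxy, Hxy. now exists S.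
Qed.
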